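(* Let $\ell>2$, let $\lambda$ be an $(\ell,0)$-JM partition and $0\le i<\ell$. Put $\widehat\varphi=\max\{n:\widehat f_i^n\lambda\ne0\}$ and $\widehat\varepsilon=\max\{n:\widehat e_i^n\lambda\ne0\}$. Then: (1) $\widehat f_i^{\widehat\varphi}\lambda$ is an $(\ell,0)$-JM partition; (2) $\widehat e_i^{\widehat\varepsilon}\lambda$ is an $(\ell,0)$-JM partition; (3) $\widehat f_i^{k}\lambda$ is not an $(\ell,0)$-JM partition for $0<k<\widehat\varphi-1$; (4) $\widehat e_i^{k}\lambda$ is not an $(\ell,0)$-JM partition for $1<k<\widehat\varepsilon$.
   Context: Partitions are identified with Young diagrams; $(x,y)$ is the box in row $x$, column $y$, with residue $y-x\bmod\ell$. The hook length $h^\lambda_{(a,c)}$ of a box is the number of boxes of $\lambda$ to its right in its row or below it in its column, including itself. $\lambda$ is an $(\ell,0)$-JM partition if there do NOT exist boxes $(a,b),(a,y),(x,b)$ in $\lambda$ with $\ell\mid h^\lambda_{(a,b)}$, $\ell\nmid h^\lambda_{(a,y)}$, $\ell\nmid h^\lambda_{(x,b)}$. Ladder crystal operators: for residue $i$, mark removable boxes of residue $i$ by $-$ and addable positions of residue $i$ by $+$; read them ordering positions $(x,y)$ by ladder number $x+(\ell-1)(y-1)$ increasing and, within a ladder, top to bottom; successively cancel adjacent pairs $-+$. Then $\widehat e_i\lambda$ removes the box of the leftmost remaining $-$ and $\widehat f_i\lambda$ adds the box of the rightmost remaining $+$ (each is $0$ if no such sign exists; $\widehat e_i0=\widehat f_i0=0$).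 *)

(* Defs.v *)
From mathcomp Require Import all_boot all_algebra.
Set Implicit Arguments.
Unset Strict Implicit.
Unset Printing Implicit Defensive.

Definition is_part (la : seq nat) : bool := sorted geq la && (0 \notin la).

(* Boxes and positions are pairs (row, column), both counted from 1. *)
Definition diagram (la : seq nat) : seq (nat * nat) :=
  [seq (x, y) | x <- iota 1 (size la), y <- iota 1 (nth 0 la x.-1)].

Definition residue (l : nat) (p : nat * nat) : int :=
  ((Posz p.2 - Posz p.1)%R %% Posz l)%Z.

Definition hook_length (la : seq nat) (a c : nat) : nat :=
  count (fun p => ((p.1 == a) && (c <= p.2)) || ((p.2 == c) && (a <= p.1)))
    (diagram la).

Definition JM_partition (l : nat) (la : seq nat) : Prop :=
  is_part la /\
  ~ (exists a b x y : nat,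
      [/\ (a, b) \in diagram la, (a, y) \in diagram la & (x, b) \in diagram la]
      /\ [/\ l %| hook_length la a b, ~~ (l %| hook_length la a y)
           & ~~ (l %| hook_length la x b)]).

Definition removable (la : seq nat) (p : nat * nat) : bool :=
  [&& p \in diagram la, (p.1.+1, p.2) \notin diagram la
    & (p.1, p.2.+1) \notin diagram la].

Definition addable (la : seq nat) (p : nat * nat) : bool :=
  [&& 0 < p.1, 0 < p.2, p \notin diagram la,
      (p.1 == 1) || ((p.1.-1, p.2) \in diagram la)
    & (p.2 == 1) || ((p.1, p.2.-1) \in diagram la)].

Definition ladder (l : nat) (p : nat * nat) : nat := p.1 + (l - 1) * (p.2 - 1).

Definition ladder_le (l : nat) (p q : nat * nat) : bool :=
  (ladder l p < ladder l q) || ((ladder l p == ladder l q) && (p.1 <= q.1)).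

(* All removable boxes and addable positions of la lie in this rectangle. *)
Definition positions (la : seq nat) : seq (nat * nat) :=
  [seq (x, y) | x <- iota 1 (size la).+1, y <- iota 1 (head 0 la).+1].

(* A sign is a boolean: true for +, false for -. *)
Definition signature (l i : nat) (la : seq nat) : seq (bool * (nat * nat)) :=
  [seq (addable la p, p)
  | p <- sort (ladder_le l)
           [seq p <- positions la | (removable la p || addable la p)
                                    && (residue l p == Posz i)]].

(* Cancellation of adjacent pairs -+, performed from the right: a - meets a +
   exactly when that + heads the already reduced sequence following it. *)
Fixpoint cancel_signs (s : seq (bool * (nat * nat))) :
    seq (bool * (nat * nat)) :=
  match s with
  | [::] => [::]
  | (false, p) :: s' =>
      if cancel_signs s' is (true, _) :: t then t
      else (false, p) :: cancel_signs s'
  | (true, p) :: s' => (true, p) :: cancel_signs s'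
  end.

Definition remaining (l i : nat) (sg : bool) (la : seq nat) : seq (nat * nat) :=
  [seq sp.2 | sp <- cancel_signs (signature l i la) & sp.1 == sg].

Definition remove_box (la : seq nat) (p : nat * nat) : seq nat :=
  [seq r <- set_nth 0 la p.1.-1 (nth 0 la p.1.-1).-1 | 0 < r].

Definition add_box (la : seq nat) (p : nat * nat) : seq nat :=
  incr_nth la p.1.-1.

(* None is the element 0 of the crystal, fixed by both operators. *)
Definition e_hat (l i : nat) : option (seq nat) -> option (seq nat) :=
  obind (fun la => omap (remove_box la) (ohead (remaining l i false la))).

Definition f_hat (l i : nat) : option (seq nat) -> option (seq nat) :=
  obind (fun la => omap (add_box la) (ohead (rev (remaining l i true la)))).

Definition is_max (P : nat -> Prop) (n : nat) : Prop :=
  P n /\ forall m : nat, P m -> m <= n.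

(* Main.v *)
Require Import Defs.
From mathcomp Require Import all_boot all_order all_algebra.
From mathcomp Require Import zify.
Set Implicit Arguments.
Unset Strict Implicit.
Unset Printing Implicit Defensive.
Import Order.TTheory GRing.Theory Num.Theory.

(* Encode a partition by its Maya diagram: beads r_a = la_a - a, gaps
   c_b = b - 1 - la'_b, which together partition Z.  Then (a, b) is a box iff
   c_b < r_a, and its hook length is r_a - c_b, so the JM condition reads: a gap
   c below a congruent bead r never has both a gap below r not congruent to r
   and a bead above c not congruent to c.  An addable (removable) i-box is a
   pair (t - 1, t), t = i mod l, in state bead-gap (gap-bead), and adding it
   (removing it) exchanges the two states.

   For a JM partition every addable i-box precedes every removable one in the
   ladder order, so nothing cancels; this persists along the string, and the
   operators add the addable i-boxes from the last to the first and remove the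
   removable ones from the first to the last.  At the ends of the string only
   one kind of i-box is left, and then a violation of the JM condition can be
   transported to the original partition.  Strictly inside, two bead-gap pairs
   and a gap-bead pair coexist, and these alone violate the condition. *)

(** * The JM condition for bead configurations on the integers *)

Local Open Scope ring_scope.

(** [S t] stands for a bead at [t] and [~~ S t] for a gap. The differences [r - c], [r - c'] and
    [r' - c] are the hook lengths of a box, of another box in its row and of another box in its
    column. *)
Definition bead_JM (l : int) (S : int -> bool) : Prop :=
  forall c r c' r', ~~ S c -> S r -> c < r -> (l %| r - c)%Z ->
    ~~ S c' -> c' < r -> S r' -> c < r' -> (l %| r - c')%Z || (l %| r' - c)%Z.

Lemma bead_JM_intro (l : int) (S : int -> bool) :
  (forall c r c' r', ~~ S c -> S r -> c < r -> (l %| r - c)%Z ->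
    ~~ S c' -> c' < r -> S r' -> c < r' ->
    ~~ (l %| r - c')%Z -> ~~ (l %| r' - c)%Z -> False) -> bead_JM l S.
Proof.
move=> H c r c' r' h1 h2 h3 h4 h5 h6 h7 h8.
by apply/negPn/negP; rewrite negb_or => /andP[]; apply: H h1 h2 h3 h4 h5 h6 h7 h8.
Qed.

Lemma bead_JM_elim (l : int) (S : int -> bool) c r c' r' :
  bead_JM l S -> ~~ S c -> S r -> c < r -> (l %| r - c)%Z ->
    ~~ S c' -> c' < r -> S r' -> c < r' ->
    ~~ (l %| r - c')%Z -> ~~ (l %| r' - c)%Z -> False.
Proof.
move=> H h1 h2 h3 h4 h5 h6 h7 h8 /negbTE n1 /negbTE n2.
by have := H _ _ _ _ h1 h2 h3 h4 h5 h6 h7 h8; rewrite n1 n2.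
Qed.

Lemma dvdz_lt_add (l c r : int) : 0 < l -> c < r -> (l %| r - c)%Z -> c + l <= r.
Proof.
move=> l0 cr /dvdzP[k hk].
have k0 : 0 < k by rewrite -(pmulr_lgt0 _ l0) -hk subr_gt0.
by rewrite addrC -lerBrDr hk ler_peMl // ltW.
Qed.

Lemma cong_sym (l a b : int) : (l %| a - b)%Z = (l %| b - a)%Z.
Proof. by rewrite -[in RHS]opprB rpredN. Qed.

Lemma cong_class (l a t u : int) :
  (l %| t - a)%Z -> (l %| t - u)%Z = (l %| u - a)%Z.
Proof.
move=> h; rewrite (_ : t - u = (t - a) - (u - a)); last by lia.
by rewrite rpredBl.
Qed.

Lemma ndvdz_unit (l e : int) : 1 < l -> e = 1 \/ e = -1 -> (l %| e)%Z = false.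
Proof. 
move=> l1 he; apply/negP; rewrite /dvdz /= => /dvdn_leq.
by case: he => ->; lia.
 Qed.

(* The divisibility and bead hypotheses would make [lia] perform very expensive
   boolean case splits. *)
Ltac order_lia :=
  repeat match goal with
  | H : is_true ?b |- _ =>
      lazymatch b with
      | @Order.lt _ _ _ _ => fail
      | @Order.le _ _ _ _ => fail
      | _ => clear H
      end
  | H : _ = false |- _ => clear H
  | H : forall _, _ |- _ => clear H
  | H : bead_JM _ _ |- _ => clear H
  end; lia.

(* Used with [j = i, e = -1] when there is no addable i-box left, and with
   [j = i - 1, e = 1] when there is no removable one: in both cases a gap of
   class [j] forces its partner to be a gap. *)
Lemma bead_JM_swap (l e j : int) (S S' : int -> bool) :
  1 < l -> e = 1 \/ e = -1 ->
  (forall t, ~~ (l %| t - j)%Z -> ~~ (l %| t - (j + e))%Z -> S' t = S t) ->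
  (forall t, (l %| t - j)%Z ->
    (S' t = S t /\ S' (t + e) = S (t + e)) \/
    (S' t = S (t + e) /\ S' (t + e) = S t)) ->
  (forall t, (l %| t - j)%Z -> S' (t + e) -> S' t) ->
  bead_JM l S -> bead_JM l S'.
Proof.
move=> l1 he Hoff Hpair Hno JS.
apply: bead_JM_intro => c r c' r' gc br cr lcr gc' cr' br' c_r' n1 n2.
have l0 : 0 < l by order_lia.
have ne : (l %| e)%Z = false by apply: ndvdz_unit.
(* By [Hno], a gap of class [j] or a bead of class [j + e] determines its whole pair in [S'], hence
   also in [S]. A gap of class [j + e] or a bead of class [j] only guarantees one member of its kind
   in the pair of [S]. *)
have gapj t : (l %| t - j)%Z -> ~~ S' t -> [/\ ~~ S t, ~~ S (t + e) & ~~ S' (t + e)].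
  by move=> tj gt; have := Hno _ tj; have := Hpair _ tj; move: gt;
    case: (S' t); case: (S' (t + e)); case: (S t); case: (S (t + e)) => //=;
    intuition.
have beadj t : (l %| t - (j + e))%Z -> S' t -> [/\ S t, S (t - e) & S' (t - e)].
  move=> tj bt; have tj' : (l %| (t - e) - j)%Z by rewrite (_ : _ - j = t - (j + e)) //; order_lia.
  have := Hno _ tj'; have := Hpair _ tj'; rewrite subrK; move: bt.
  by case: (S' t); case: (S' (t - e)); case: (S t); case: (S (t - e)) => //=; intuition.
have gapk t : (l %| t - (j + e))%Z -> ~~ S' t -> ~~ S t \/ ~~ S (t - e).
  move=> tj bt; have tj' : (l %| (t - e) - j)%Z by rewrite (_ : _ - j = t - (j + e)) //; order_lia.
  have := Hpair _ tj'; rewrite subrK; move: bt.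
  by case: (S' t); case: (S' (t - e)); case: (S t); case: (S (t - e)) => //=; intuition.
have beadk t : (l %| t - j)%Z -> S' t -> S t \/ S (t + e).
  move=> tj bt; have := Hpair _ tj; move: bt.
  by case: (S' t); case: (S' (t + e)); case: (S t); case: (S (t + e)) => //=; intuition.
have cl := dvdz_lt_add l0 cr lcr.
have JK t : (l %| t - j)%Z -> (l %| t - (j + e))%Z = false.
  by move=> h; rewrite (cong_class _ h) addrAC subrr add0r.
have KJ t : (l %| t - (j + e))%Z -> (l %| t - j)%Z = false.
  by move=> h; apply/negP => /JK; rewrite h.
have shK t : (l %| (t + e) - (j + e))%Z = (l %| t - j)%Z by congr (_ %| _)%Z; order_lia.
have shJ t : (l %| (t - e) - j)%Z = (l %| t - (j + e))%Z by congr (_ %| _)%Z; order_lia.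
have shl : (l %| (r + e) - (c + e))%Z by rewrite (_ : _ - _ = r - c) //; order_lia.
have shl' : (l %| (r - e) - (c - e))%Z by rewrite (_ : _ - _ = r - c) //; order_lia.
(* Class [j]: [c] and [c + e] are both gaps of [S], and [S] has a bead at [r] or at [r + e]. With a
   bead at [r], the gap [c + e] is the one not congruent to [r]; otherwise the violation is shifted
   by [e] and [c] becomes that gap. *)
case: (boolP (l %| r - j)%Z) => rj.
  have cj : (l %| c - j)%Z by rewrite -(cong_class _ rj).
  have [gc1 gc2 gc3] := gapj _ cj gc.
  have r'j : ~~ (l %| r' - j)%Z by rewrite -(cong_class _ cj) cong_sym.
  have r'c : r' <> c + e by move=> E; rewrite -E br' in gc3.
  have Sr' : S r'.
    case: (boolP (l %| r' - (j + e))%Z) => h; first by case: (beadj _ h br').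
    by rewrite -Hoff.
  have [Sr|Sr] := beadk _ rj br.
    apply: (bead_JM_elim (c' := c + e) (r' := r') JS gc1 Sr) => //; first by order_lia.
    by rewrite (cong_class _ rj); apply/negP => /JK; rewrite shK cj.
  have n3 : ~~ (l %| r + e - c)%Z.
    by rewrite cong_sym (cong_class _ cj); apply/negP => /JK; rewrite shK rj.
  (* A bead [r'] congruent to the shifted gap [c + e] cannot serve, but its partner [r' - e] is a
     bead as well. *)
  case: (boolP (l %| r' - (j + e))%Z) => h.
    have [_ h2 _] := beadj _ h br'.
    have lr' : (l %| r' - (c + e))%Z by rewrite (cong_class _ h) shK.
    apply: (bead_JM_elim (c' := c) (r' := r' - e) JS gc2 Sr) => //; try order_lia.
      by case: (ltrP (c + e) r') => [/(dvdz_lt_add l0)/(_ lr')|]; order_lia.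
    by rewrite (cong_class (a := j)) ?shJ //; apply/negP => /JK; rewrite shK cj.
  apply: (bead_JM_elim (c' := c) (r' := r') JS gc2 Sr) => //; try order_lia.
  by rewrite cong_sym (cong_class (a := j + e)) ?shK.
(* Class [j + e] is the mirror image: beads and gaps are exchanged and the order is reversed. *)
case: (boolP (l %| r - (j + e))%Z) => rk.
  have ck : (l %| c - (j + e))%Z by rewrite -(cong_class _ rk).
  have [br1 br2 br3] := beadj _ rk br.
  have c'k : ~~ (l %| c' - (j + e))%Z by rewrite -(cong_class _ rk).
  have c'r : c' <> r - e by move=> E; rewrite E br3 in gc'.
  have Sc' : ~~ S c'.
    case: (boolP (l %| c' - j)%Z) => h; first by case: (gapj _ h gc').
    by rewrite -Hoff.
  have [Sc|Sc] := gapk _ ck gc.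
    apply: (bead_JM_elim (c' := c') (r' := r - e) JS Sc br1) => //; first by order_lia.
    by rewrite (cong_class (a := j)) ?shJ //; apply/negP => /JK; rewrite ck.
  have n3 : ~~ (l %| r - (c - e))%Z.
    by rewrite (cong_class _ rk); apply/negP => /KJ; rewrite shJ ck.
  case: (boolP (l %| c' - j)%Z) => h.
    have [_ h2 _] := gapj _ h gc'.
    have lr' : (l %| r - (c' + e))%Z by rewrite (cong_class _ rk) shK.
    apply: (bead_JM_elim (c' := c' + e) (r' := r) JS Sc br2) => //; try order_lia.
      by case: (ltrP (c' + e) r) => [/(dvdz_lt_add l0)/(_ lr')|]; order_lia.
    by rewrite (cong_class (a := j)) ?shJ //; apply/negP => /JK; rewrite shK h.
  apply: (bead_JM_elim (c' := c') (r' := r) JS Sc br2) => //; try order_lia.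
  by rewrite (cong_class (a := j)) ?shJ.
(* In the remaining classes [c] and [r] are untouched. If [c'] or [r'] was moved, its partner
   replaces it, still not congruent to [r] or [c]. *)
have cj : ~~ (l %| c - j)%Z by rewrite cong_sym -(cong_class _ lcr).
have ck : ~~ (l %| c - (j + e))%Z by rewrite cong_sym -(cong_class _ lcr).
have Sc : ~~ S c by rewrite -Hoff.
have Sr : S r by rewrite -Hoff.
have [c2 [Sc2 c2r nc2]] : exists c2, [/\ ~~ S c2, c2 < r & ~~ (l %| r - c2)%Z].
  case: (boolP (l %| c' - j)%Z) => h; first by exists c'; have [] := gapj _ h gc'.
  case: (boolP (l %| c' - (j + e))%Z) => h'; last by exists c'; rewrite -Hoff.
  have [hS|hS] := gapk _ h' gc'; first by exists c'.
  exists (c' - e); split=> //; last by rewrite cong_sym (cong_class (a := j)) ?shJ.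
  have : c' - e <> r by move=> E; move: rj; rewrite -E shJ h'.
  order_lia.
have [r2 [Sr2 c2r' nr2]] : exists r2, [/\ S r2, c < r2 & ~~ (l %| r2 - c)%Z].
  case: (boolP (l %| r' - (j + e))%Z) => h; first by exists r'; have [] := beadj _ h br'.
  case: (boolP (l %| r' - j)%Z) => h'; last by exists r'; rewrite -Hoff.
  have [hS|hS] := beadk _ h' br'; first by exists r'.
  exists (r' + e); split=> //; last by rewrite (cong_class (a := j + e)) ?shK.
  have : r' + e <> c by move=> E; move: ck; rewrite -E shK h'.
  order_lia.
exact: (bead_JM_elim (c' := c2) (r' := r2) JS Sc Sr).
Qed.

(** If [v < u2], the gap [v - 1] lies below the congruent bead [u2 - 1], and the gap [u1] and the
    bead [v] complete the violation. If [v > u2], the gap [u1] and the bead [v] are completed by the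
    gap [v - 1] and the bead [u2 - 1], which is above [u1] because [u1 + l <= u2]. *)
Lemma not_bead_JM_mixed (l i u1 u2 v : int) (S : int -> bool) :
  1 < l -> (l %| u1 - i)%Z -> (l %| u2 - i)%Z -> (l %| v - i)%Z ->
  u1 < u2 -> S (u1 - 1) -> ~~ S u1 -> S (u2 - 1) -> ~~ S u2 ->
  ~~ S (v - 1) -> S v -> ~ bead_JM l S.
Proof.
move=> l1 h1 h2 hv u12 b1 g1 b2 g2 gv bv JS.
have l0 : 0 < l by order_lia.
have n1 : (l %| -1)%Z = false by apply: ndvdz_unit => //; right.
have hu : (l %| u2 - u1)%Z by rewrite (cong_class _ h2).
have hvu1 : (l %| v - u1)%Z by rewrite (cong_class _ hv).
have hvu2 : (l %| v - u2)%Z by rewrite (cong_class _ hv).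
have vu2 : v <> u2 by move=> E; rewrite E (negbTE g2) in bv.
have lt12 := dvdz_lt_add l0 u12 hu.
have sh x y : (l %| x - y)%Z -> (l %| (x - 1) - y)%Z = false.
  by move=> h; rewrite addrAC rpredDl.
case: (ltrP v u2) => h.
  apply: (bead_JM_elim (c := v - 1) (r := u2 - 1) (c' := u1) (r' := v) JS) => //; try order_lia.
  - by rewrite (_ : _ - _ = u2 - v); [rewrite cong_sym|order_lia].
  - by rewrite sh.
  - by rewrite cong_sym sh // subrr.
have lt2 : u2 + l <= v by apply: dvdz_lt_add => //; order_lia.
apply: (bead_JM_elim (c := u1) (r := v) (c' := v - 1) (r' := u2 - 1) JS) => //; try order_lia.
- by rewrite cong_sym sh // subrr.
- by rewrite sh.
Qed.

Local Close Scope ring_scope.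

(** * Partitions, their Maya diagrams and hook lengths *)

Lemma is_partP (la : seq nat) :
  reflect ((forall k, nth 0 la k.+1 <= nth 0 la k) /\
           (forall k, k < size la -> 0 < nth 0 la k)) (is_part la).
Proof.
apply: (iffP andP) => [[/(sortedP 0) hs h0] | [hs h0]]; split.
- move=> k; case: (ltnP k.+1 (size la)) => hk; first exact: hs.
  by rewrite nth_default.
- by move=> k hk; rewrite lt0n; apply: contra h0 => /eqP <-; exact: mem_nth.
- by apply/(sortedP 0) => k _; exact: hs.
- by apply/(nthP 0) => -[k /h0 hk E]; rewrite E in hk.
Qed.

Lemma nth_part (la : seq nat) (j k : nat) :
  is_part la -> j <= k -> nth 0 la k <= nth 0 la j.
Proof.
move=> /is_partP[hs _]; elim: k => [|k IH]; first by rewrite leqn0 => /eqP->.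
by rewrite leq_eqVlt => /predU1P[->//|/IH]; apply: leq_trans.
Qed.

Lemma mem_diagram (la : seq nat) (x y : nat) :
  ((x, y) \in diagram la) = [&& 0 < x, 0 < y & y <= nth 0 la x.-1].
Proof.
rewrite /diagram; apply/allpairsPdep/and3P => [[a [b [ha hb [-> ->]]]]|[x0 y0 hy]].
  by move: ha hb; rewrite !mem_iota => ? ?; split; lia.
exists x, y; split=> //; rewrite mem_iota; last by lia.
by case: (ltnP x.-1 (size la)) hy => [|/(nth_default 0) ->]; lia.
Qed.

(** For a partition and [0 < y] this is the part of index [y] of the conjugate partition. *)
Definition col_len (la : seq nat) (y : nat) : nat := find (fun r => r < y) la.

Lemma ltn_col_len (la : seq nat) (k y : nat) :
  is_part la -> 0 < y -> (k < col_len la y) = (y <= nth 0 la k).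
Proof.
move=> hp y0; apply/idP/idP => [/(before_find 0)|]; first by lia.
apply: contraTT; rewrite -leqNgt -ltnNge => /(nth_part hp) /leq_ltn_trans; apply.
rewrite /col_len; case: (boolP (has (fun r => r < y) la)) => [/(nth_find 0)//|].
by move=> /hasNfind ->; rewrite nth_default.
Qed.

(** Conjugation in a form that [lia] can split on: each case carries the inequality for the row and
    the one for the column. *)
Lemma col_len_cases (la : seq nat) (k y : nat) :
  is_part la -> 0 < y ->
  (k < col_len la y /\ y <= nth 0 la k) \/ (col_len la y <= k /\ nth 0 la k < y).
Proof.
move=> hp y0; have := ltn_col_len k hp y0.
by case: (leqP y) => h E; [left|right; rewrite leqNgt E].
Qed.

(* [rowpos] and [colpos] label the vertical and the horizontal steps of the rim
   by contents: they are the beads and the gaps of the Maya diagram. *)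
Definition rowpos (la : seq nat) (a : nat) : int :=
  (Posz (nth 0%N la a.-1) - Posz a)%R.

Definition colpos (la : seq nat) (b : nat) : int :=
  (Posz b - 1 - Posz (col_len la b))%R.

(* The empty rows [a > size la] contribute the beads [- a], so the search is
   bounded in terms of [t]. *)
Definition bead (la : seq nat) (t : int) : bool :=
  has (fun a => t == rowpos la a) (iota 1 (size la + `|t|)).

Lemma beadP (la : seq nat) (t : int) :
  reflect (exists2 a, 0 < a & t = rowpos la a) (bead la t).
Proof.
apply: (iffP hasP) => [[a]|[a a0 E]].
  by rewrite mem_iota => /andP[a0 _] /eqP ->; exists a.
exists a; last by rewrite E.
rewrite mem_iota a0 E /rowpos /=.
by case: (ltnP a.-1 (size la)) => h; [|rewrite nth_default //]; lia.
Qed.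

Lemma colpos_lt_rowpos (la : seq nat) (a b : nat) :
  is_part la -> 0 < a -> 0 < b ->
  (colpos la b < rowpos la a)%R = ((a, b) \in diagram la).
Proof.
move=> hp a0 b0; rewrite mem_diagram a0 b0 /=.
have := col_len_cases a.-1 hp b0; rewrite /colpos /rowpos.
by move=> h; apply/idP/idP; lia.
Qed.

Lemma rowpos_neq_colpos (la : seq nat) (a b : nat) :
  is_part la -> 0 < a -> 0 < b -> rowpos la a <> colpos la b.
Proof.
move=> hp a0 b0; have := col_len_cases a.-1 hp b0; rewrite /colpos /rowpos.
by lia.
Qed.

Lemma rowpos_inj (la : seq nat) (a b : nat) :
  is_part la -> 0 < a -> 0 < b -> rowpos la a = rowpos la b -> a = b.
Proof.
move=> hp; wlog ab : a b / a <= b.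
  by move=> H a0 b0 E; case: (leqP a b) => h; [|symmetry]; apply: H; lia.
move=> a0 b0; have : nth 0 la b.-1 <= nth 0 la a.-1 by apply: nth_part => //; lia.
rewrite /rowpos; lia.
Qed.

Lemma gapP (la : seq nat) (t : int) :
  is_part la -> reflect (exists2 b, 0 < b & t = colpos la b) (~~ bead la t).
Proof.
move=> hp; apply: (iffP idP) => [nb|[b b0 E]]; last first.
  by apply/negP => /beadP[a a0]; rewrite E => /esym; apply: rowpos_neq_colpos.
have ex : exists k, (rowpos la k.+1 <= t)%R.
  (* This row is empty, and its bead is far enough to the left. *)
  exists (size la + `|t|); rewrite /rowpos nth_default /=; lia.
have := ex_minnP ex => -[k hk kmin].
have ht : (rowpos la k.+1 < t)%R.
  rewrite lt_neqAle hk andbT; apply: contra nb => /eqP <-.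
  by apply/beadP; exists k.+1.
have b0 : (0 < t + Posz k + 1)%R by move: ht; rewrite /rowpos; lia.
(* By minimality of [k], [t] lies strictly between the beads of rows [k + 1] and [k] (if [0 < k]),
   so exactly [k] rows reach column [t + k + 1], whose gap is therefore [t]. *)
exists `|(t + Posz k + 1)%R|%N; first by lia.
have b0' : 0 < `|(t + Posz k + 1)%R|%N by lia.
suff : col_len la `|(t + Posz k + 1)%R|%N = k by rewrite /colpos; lia.
have h1 := col_len_cases k hp b0'.
move: ht; rewrite /rowpos /= => ht.
case: k kmin hk ht b0 b0' h1 => [|k] kmin hk ht b0 b0' h1; first by lia.
have := kmin k; rewrite /rowpos /= => h2.
have := col_len_cases k hp b0'; lia.
Qed.

Lemma diagram_uniq (la : seq nat) : uniq (diagram la).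
Proof.
apply: allpairs_uniq_dep => [|x _|[a b] [c d] _ _ [-> ->]] //; exact: iota_uniq.
Qed.

Lemma hook_lengthE (la : seq nat) (a b : nat) :
  is_part la -> (a, b) \in diagram la ->
  Posz (hook_length la a b) = (rowpos la a - colpos la b)%R.
Proof.
move=> hp hab; have := hab; rewrite mem_diagram => /and3P[a0 b0 hb].
(* The corner is counted in the arm, so the leg starts at row [a + 1]. *)
pose arm := [seq (a, y) | y <- iota b (nth 0 la a.-1 - b).+1].
pose leg := [seq (x, b) | x <- iota a.+1 (col_len la b - a)].
have ha := col_len_cases a.-1 hp b0.
have E : hook_length la a b = size (arm ++ leg).
  rewrite /hook_length -size_filter; apply: perm_size; apply: uniq_perm.
  - exact/filter_uniq/diagram_uniq.
  - rewrite cat_uniq !map_inj_uniq ?iota_uniq ?andbT /=; try by move=> ? ? [].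
    apply/hasPn => -[x y] /mapP[z]; rewrite mem_iota => hz [-> ->].
    by apply/mapP => -[w _ [E _]]; lia.
  move=> [x y]; rewrite mem_filter mem_cat mem_diagram /=.
  apply/andP/orP => [[/orP[/andP[/eqP -> h1]|/andP[/eqP -> h1]] /and3P[x0 y0 h2]]|].
  - by left; apply/mapP; exists y => //; rewrite mem_iota; lia.
  - move: (h1); rewrite leq_eqVlt => /predU1P[ax|ax].
      by left; apply/mapP; exists b; rewrite -?ax // mem_iota; lia.
    right; apply/mapP; exists x => //; rewrite mem_iota.
    by have := col_len_cases x.-1 hp b0; lia.
  - case=> /mapP[z]; rewrite mem_iota => hz [-> ->]; first by rewrite eqxx; lia.
    rewrite eqxx /=; have := col_len_cases z.-1 hp b0.
    by split; lia.
rewrite E size_cat !size_map !size_iota /rowpos /colpos; lia.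
Qed.

Lemma JM_partitionE (l : nat) (la : seq nat) :
  is_part la -> JM_partition l la <-> bead_JM (Posz l) (bead la).
Proof.
move=> hp; split=> [[_ H]|H].
  apply: bead_JM_intro => c r c' r' /(gapP _ hp)[b b0 ->] /beadP[a a0 ->] h1 h2.
  move=> /(gapP _ hp)[y y0 ->] h3 /beadP[x x0 ->] h4 n1 n2; apply: H.
  rewrite colpos_lt_rowpos // in h1; rewrite colpos_lt_rowpos // in h3.
  rewrite colpos_lt_rowpos // in h4.
  exists a, b, x, y; split=> //.
  by move: h2 n1 n2; rewrite -!hook_lengthE.
split=> // -[a [b [x [y [[h1 h2 h3] [d1 d2 d3]]]]]].
have := h1; rewrite mem_diagram => /and3P[a0 b0 _].
have := h2; rewrite mem_diagram => /and3P[_ y0 _].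
have := h3; rewrite mem_diagram => /and3P[x0 _ _].
have gap z : 0 < z -> ~~ bead la (colpos la z) by move=> z0; apply/gapP; try exists z.
have bd z : 0 < z -> bead la (rowpos la z) by move=> z0; apply/beadP; exists z.
apply: (bead_JM_elim (c := colpos la b) (r := rowpos la a)
  (c' := colpos la y) (r' := rowpos la x) H); rewrite ?gap ?bd ?colpos_lt_rowpos //;
  by rewrite -hook_lengthE.
Qed.

(** * Addable and removable boxes, and the effect of adding one box *)

Lemma addableE (la : seq nat) (x y : nat) :
  addable la (x, y) =
  [&& 0 < x, y == (nth 0 la x.-1).+1 & (x == 1) || (y <= nth 0 la x.-2)].
Proof. by rewrite /addable !mem_diagram /=; lia. Qed.

Lemma removableE (la : seq nat) (x y : nat) :
  removable la (x, y) =
  [&& 0 < x, 0 < y, y == nth 0 la x.-1 & nth 0 la x < y].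
Proof. by rewrite /removable !mem_diagram /=; lia. Qed.

(** One relation serves both operators, with [la] and [mu] exchanged for removal. Comparing rows
    through [nth 0] covers the creation and the deletion of a row. *)
Definition box_added (la mu : seq nat) (p : nat * nat) : Prop :=
  [/\ is_part la, is_part mu, 0 < p.1, p.2 = (nth 0 la p.1.-1).+1
    & forall k, nth 0 mu k = nth 0 la k + (k == p.1.-1)].

Lemma add_boxP (la : seq nat) (p : nat * nat) :
  is_part la -> addable la p -> box_added la (add_box la p) p.
Proof.
case: p => x y hp; rewrite addableE => /and3P[x0 /eqP hy hx].
have row k : nth 0 (add_box la (x, y)) k = nth 0 la k + (k == x.-1).
  by rewrite nth_incr_nth /= eq_sym addnC.
split=> //; have /is_partP[h1 h2] := hp; apply/is_partP; split=> k.
  rewrite !row; have := h1 k; case: (k.+1 =P x.-1) => E; last by lia.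
  by move: hx; rewrite -[x.-2]/(x.-1.-1) -E /= hy -E; lia.
rewrite row size_incr_nth; case: (ltnP x.-1 (size la)) => hs /= hk; first by have := h2 _ hk; lia.
case: (ltnP k (size la)) => [/h2|hk']; first by lia.
(* A box added below the last row has a nonempty row above it or is in the first row, so [incr_nth]
   pads with no zero row. *)
have : x.-2 < size la \/ x.-1 = 0.
  by case: (ltnP x.-2 (size la)) hx => [|/(nth_default 0) ->]; [left|right; lia].
lia.
Qed.

(** In a weakly decreasing sequence the zeros come last, so filtering shifts nothing and the default
    value 0 replaces what is dropped. *)
Lemma nth_filter_pos (s : seq nat) (k : nat) :
  (forall j, nth 0 s j.+1 <= nth 0 s j) -> nth 0 [seq r <- s | 0 < r] k = nth 0 s k.
Proof.
elim: s k => [|r s IH] k hs //=.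
have hs' j : nth 0 s j.+1 <= nth 0 s j := hs j.+1.
case: (posnP r) => [r0|r0] /=; last by case: k => [|k] //=; exact: IH.
rewrite IH //; have hz j : nth 0 s j = 0.
  by elim: j => [|j IHj]; [have := hs 0 | have := hs' j]; rewrite /= ?r0; lia.
by rewrite hz; case: k => [|k] /=; rewrite ?r0 ?hz.
Qed.

Lemma remove_boxP (la : seq nat) (p : nat * nat) :
  is_part la -> removable la p -> box_added (remove_box la p) la p.
Proof.
case: p => x y hp; rewrite removableE => /and4P[x0 y0 /eqP hy hx].
have /is_partP[h1 h2] := hp.
pose s := set_nth 0 la x.-1 (nth 0 la x.-1).-1.
have rs k : nth 0 s k = nth 0 la k - (k == x.-1).
  by rewrite nth_set_nth /=; case: eqP => [->|_]; lia.
have srt k : nth 0 s k.+1 <= nth 0 s k.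
  rewrite !rs; have := h1 k; case: (k =P x.-1) => E; last by lia.
  by move: hx; rewrite hy E (_ : x.-1.+1 = x); lia.
have row k : nth 0 (remove_box la (x, y)) k = nth 0 la k - (k == x.-1).
  by rewrite /remove_box nth_filter_pos.
split=> //=.
- apply/is_partP; split=> k; first by rewrite !row -!rs.
  move=> hk; have : nth 0 (remove_box la (x, y)) k \in remove_box la (x, y).
    exact: mem_nth.
  by rewrite {2}/remove_box mem_filter => /andP[].
- by rewrite row eqxx -hy; lia.
- by move=> k; rewrite row; case: (k =P x.-1) => [->|_]; lia.
Qed.

Definition content (p : nat * nat) : int := (Posz p.2 - Posz p.1)%R.

Lemma addable_bead (la : seq nat) (p : nat * nat) :
  is_part la -> addable la p ->
  bead la (content p - 1)%R /\ ~~ bead la (content p).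
Proof.
case: p => x y hp; rewrite addableE /content /= => /and3P[x0 /eqP hy hx].
split; first by apply/beadP; exists x; rewrite ?hy /rowpos; lia.
apply/gapP => //; exists y; first by lia.
have y0 : 0 < y by lia.
have := col_len_cases x.-1 hp y0; have := col_len_cases x.-2 hp y0.
rewrite /colpos; lia.
Qed.

Lemma removable_bead (la : seq nat) (p : nat * nat) :
  is_part la -> removable la p ->
  ~~ bead la (content p - 1)%R /\ bead la (content p).
Proof.
case: p => x y hp; rewrite removableE /content /= => /and4P[x0 y0 /eqP hy hx].
split; last by apply/beadP; exists x; rewrite ?hy /rowpos; lia.
apply/gapP => //; exists y => //.
have := col_len_cases x.-1 hp y0; have := col_len_cases x hp y0.
rewrite /colpos; lia.
Qed.

Lemma addable_of_bead (la : seq nat) (m : int) :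
  is_part la -> bead la (m - 1)%R -> ~~ bead la m ->
  exists2 p, addable la p & content p = m.
Proof.
move=> hp /beadP[x x0 hx] nb; exists (x, (nth 0 la x.-1).+1); last first.
  by move: hx; rewrite /content /rowpos /=; lia.
rewrite addableE x0 eqxx /=; case: (x =P 1) => //= x1.
(* Otherwise the row above has the same length and its bead is at [m]. *)
rewrite ltnNge; apply: contra nb => h; apply/beadP; exists x.-1; first by lia.
have := @nth_part la x.-2 x.-1 hp; move: hx; rewrite /rowpos; lia.
Qed.

Lemma removable_of_bead (la : seq nat) (m : int) :
  is_part la -> ~~ bead la (m - 1)%R -> bead la m ->
  exists2 p, removable la p & content p = m.
Proof.
move=> hp nb /beadP[x x0 hx]; have nb' : nth 0 la x < nth 0 la x.-1.
  (* Otherwise the next row has the same length and its bead is at [m - 1]. *)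
  rewrite ltnNge; apply: contra nb => h; apply/beadP; exists x.+1 => //.
  have := @nth_part la x.-1 x hp; move: hx; rewrite /rowpos /=; lia.
exists (x, nth 0 la x.-1); first by rewrite removableE x0 eqxx nb'; lia.
by move: hx; rewrite /content /rowpos /=; lia.
Qed.

Lemma addable_content_inj (la : seq nat) (p q : nat * nat) :
  is_part la -> addable la p -> addable la q -> content p = content q -> p = q.
Proof.
case: p q => [x y] [x' y'] hp; rewrite !addableE /content /=.
move=> /and3P[x0 /eqP hy _] /and3P[x0' /eqP hy' _] E.
have xx : x = x' by apply: (rowpos_inj hp) => //; rewrite /rowpos; lia.
by rewrite hy hy' xx.
Qed.

Lemma box_added_addable (la mu : seq nat) (p : nat * nat)
    (hadd : box_added la mu p) : addable la p.
Proof.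
case: p hadd => x y [hp /is_partP[h _] /= x0 hy hr].
rewrite addableE x0 hy eqxx /=; case: (x =P 1) => //= x1.
have := h x.-2; rewrite !hr (_ : x.-2.+1 = x.-1); lia.
Qed.

Lemma box_added_removable (la mu : seq nat) (p : nat * nat)
    (hadd : box_added la mu p) : removable mu p.
Proof.
case: p hadd => x y [/is_partP[h _] _ /= x0 hy hr].
rewrite removableE x0 hy !hr; have := h x.-1; rewrite (_ : x.-1.+1 = x); lia.
Qed.

Lemma box_added_not_addable (la mu : seq nat) (p : nat * nat)
    (hadd : box_added la mu p) : ~~ addable mu p.
Proof. by have := box_added_removable hadd; rewrite /addable => /and3P[->]; rewrite !andbF. Qed.

Lemma box_added_not_removable (la mu : seq nat) (p : nat * nat)
    (hadd : box_added la mu p) : ~~ removable la p.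
Proof. by have := box_added_addable hadd; rewrite /removable => /and5P[_ _ /negbTE ->]. Qed.

Lemma box_added_bead (la mu : seq nat) (p : nat * nat)
    (hadd : box_added la mu p) (t : int) :
  bead mu t = (t == content p) || (t != content p - 1)%R && bead la t.
Proof.
case: (hadd) => hp hq p0 hy hr.
have [b1 b2] := addable_bead hp (box_added_addable hadd).
have [b3 b4] := removable_bead hq (box_added_removable hadd).
case: (t =P content p) => [->|n1] //; case: (t =P _) => [->|n2] /=; first exact/negbTE.
apply/beadP/beadP => -[a a0 E]; exists a => //; rewrite E /rowpos hr.
all: case: (a.-1 =P p.1.-1) => h; last by rewrite addn0.
all: by move: n1 n2; rewrite E /rowpos ?hr h /content hy; lia.
Qed.

(** Besides [p], adding [p] can only affect positions whose content differs from that of [p] by 1,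
    and these have another residue. *)
Lemma box_added_neighbours (la mu : seq nat) (p : nat * nat)
    (hadd : box_added la mu p)
    (l : nat) (q : nat * nat) :
  1 < l -> (Posz l %| (content q - content p)%R)%Z -> q <> p ->
  addable mu q = addable la q /\ removable mu q = removable la q.
Proof.
move=> l1 hl qp; have l1' : (1 < Posz l)%R by lia.
have n1 : content q <> (content p + 1)%R.
  by move=> E; move: hl; rewrite E addrAC subrr add0r ndvdz_unit //; left.
have n2 : content q <> (content p - 1)%R.
  by move=> E; move: hl; rewrite E addrAC subrr add0r ndvdz_unit //; right.
case: p q hadd {hl} qp n1 n2 => [x y] [x' y'] [hp hq /= x0 hy hr] qp.
rewrite /content /= => n1 n2.
have n3 : ~ (x' = x /\ y' = y) by move=> [E1 E2]; apply: qp; rewrite E1 E2.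
rewrite !addableE !removableE !hr.
split.
  case: (x' =P 0) => [->//|x0'].
  case: (x'.-1 =P x.-1) => E; first by rewrite E; lia.
  case: (x'.-2 =P x.-1) => E'; first by rewrite E'; lia.
  lia.
case: (x' =P 0) => [->//|x0'].
case: (x'.-1 =P x.-1) => E; first by rewrite E; lia.
case: (x' =P x.-1) => E'; first by rewrite E'; lia.
lia.
Qed.

(** * Counting the addable and removable boxes of one residue *)

Lemma addable_positions (la : seq nat) (p : nat * nat) :
  is_part la -> addable la p -> p \in positions la.
Proof.
case: p => x y hp; rewrite addableE => /and3P[x0 /eqP hy hx].
have := @nth_part la 0 x.-1 hp (leq0n _); rewrite nth0 => h.
apply/allpairsP; exists (x, y); split=> //; rewrite mem_iota -?[(x, y).1]/x -?[(x, y).2]/y; last by lia.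
by case: (ltnP x.-2 (size la)) hx => [|/(nth_default 0) ->]; lia.
Qed.

Lemma removable_positions (la : seq nat) (p : nat * nat) :
  is_part la -> removable la p -> p \in positions la.
Proof.
case: p => x y hp; rewrite removableE => /and4P[x0 y0 /eqP hy _].
have := @nth_part la 0 x.-1 hp (leq0n _); rewrite nth0 => h.
apply/allpairsP; exists (x, y); split=> //; rewrite mem_iota -?[(x, y).1]/x -?[(x, y).2]/y; last by lia.
by case: (ltnP x.-1 (size la)) hy => [|/(nth_default 0) ->]; lia.
Qed.

Lemma positions_uniq (la : seq nat) : uniq (positions la).
Proof. by apply: allpairs_uniq => [||[a b] [c d] _ _ [-> ->]] //; exact: iota_uniq. Qed.

Lemma residueE (l i : nat) (p : nat * nat) : i < l ->
  (residue l p == Posz i) = (Posz l %| (content p - Posz i)%R)%Z.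
Proof.
move=> il; rewrite -eqz_mod_dvd /residue /content.
by rewrite [X in _ = (_ == X)]modz_small //; lia.
Qed.

Lemma residue_cong (l : nat) (p q : nat * nat) :
  residue l p = residue l q -> (Posz l %| (content p - content q)%R)%Z.
Proof. by move=> E; rewrite -eqz_mod_dvd; apply/eqP. Qed.

Definition addables (l i : nat) (la : seq nat) : seq (nat * nat) :=
  [seq p <- positions la | addable la p && (residue l p == Posz i)].

Definition removables (l i : nat) (la : seq nat) : seq (nat * nat) :=
  [seq p <- positions la | removable la p && (residue l p == Posz i)].

Lemma mem_addables (l i : nat) (la : seq nat) (p : nat * nat) : is_part la ->
  (p \in addables l i la) = addable la p && (residue l p == Posz i).
Proof.
move=> hp; rewrite mem_filter; case: (boolP (addable la p)) => //= /(addable_positions hp) ->.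
by rewrite andbT.
Qed.

Lemma mem_removables (l i : nat) (la : seq nat) (p : nat * nat) : is_part la ->
  (p \in removables l i la) = removable la p && (residue l p == Posz i).
Proof.
move=> hp; rewrite mem_filter; case: (boolP (removable la p)) => //= /(removable_positions hp) ->.
by rewrite andbT.
Qed.

Lemma box_added_sizes (l i : nat) (la mu : seq nat) (p : nat * nat) :
  1 < l -> box_added la mu p -> residue l p = Posz i ->
  size (addables l i la) = (size (addables l i mu)).+1 /\
  size (removables l i mu) = (size (removables l i la)).+1.
Proof.
move=> l1 hadd hp; have [pla pmu _ _ _] := hadd.
have nb q : residue l q = Posz i -> q <> p ->
    addable mu q = addable la q /\ removable mu q = removable la q.
  by move=> hq; apply: (box_added_neighbours hadd l1); apply: residue_cong; rewrite hq.
have na := negbTE (box_added_not_addable hadd).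
have nr := negbTE (box_added_not_removable hadd).
split; rewrite -[RHS]/(size (p :: _)); apply: perm_size; apply: uniq_perm;
  rewrite ?cons_uniq ?filter_uniq ?positions_uniq ?mem_addables ?mem_removables ?na ?nr //.
  move=> q; rewrite in_cons !mem_addables //; case: (q =P p) => [->|qp] /=.
    by rewrite (box_added_addable hadd) hp eqxx.
  by case: (residue l q =P Posz i) => [/nb/(_ qp)[-> _]|]; rewrite ?andbF.
move=> q; rewrite in_cons !mem_removables //; case: (q =P p) => [->|qp] /=.
  by rewrite (box_added_removable hadd) hp eqxx.
by case: (residue l q =P Posz i) => [/nb/(_ qp)[_ ->]|]; rewrite ?andbF.
Qed.

(** * The ladder order, and signatures without cancellation *)

Lemma ladder_le_total (l : nat) : total (ladder_le l).
Proof. by move=> p q; rewrite /ladder_le; lia. Qed.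

Lemma ladder_le_trans (l : nat) : transitive (ladder_le l).
Proof. by move=> p q r; rewrite /ladder_le; lia. Qed.

(** Positive columns matter: the truncated [p.2 - 1] in [ladder] identifies columns 0 and 1. *)
Lemma ladder_le_anti (l : nat) (p q : nat * nat) : 1 < l ->
  0 < p.2 -> 0 < q.2 -> ladder_le l p q -> ladder_le l q p -> p = q.
Proof.
case: p q => [x y] [x' y'] l1 /= y0 y0'; rewrite /ladder_le /= => h1 h2.
have hx : x = x' by lia.
have /eqP : ladder l (x, y) = ladder l (x', y') by lia.
rewrite hx /ladder /= eqn_add2l eqn_mul2l => /orP[|/eqP h]; first by lia.
by congr pair; lia.
Qed.

(** In such a word only minus signs follow a minus sign, so it never meets a plus sign at the head
    of the reduced tail. *)
Lemma cancel_signs_id (s : seq (bool * (nat * nat))) :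
  pairwise (fun a b => a.1 || ~~ b.1) s -> cancel_signs s = s.
Proof.
elim: s => [//|[[] p] s IH] /= /andP[h /IH ->] //.
by case: s h {IH} => [//|[[] q] s].
Qed.

(** This is the invariant of the strings. As the ladder order is total, the negation means that [q]
    comes strictly before [p]. *)
Definition plus_before_minus (l i : nat) (la : seq nat) : Prop :=
  forall p q, removable la p -> addable la q ->
    residue l p = Posz i -> residue l q = Posz i -> ~~ ladder_le l p q.

Definition signed_boxes (l i : nat) (la : seq nat) : seq (nat * nat) :=
  sort (ladder_le l) [seq p <- positions la
    | (removable la p || addable la p) && (residue l p == Posz i)].

Lemma mem_signed_boxes (l i : nat) (la : seq nat) (p : nat * nat) : is_part la ->
  (p \in signed_boxes l i la) =
  (removable la p || addable la p) && (residue l p == Posz i).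
Proof.
move=> hp; rewrite mem_sort mem_filter; case: (boolP (_ || _)) => //= /orP h.
by rewrite (_ : p \in _) ?andbT //; case: h; [apply: removable_positions|apply: addable_positions].
Qed.

Lemma removable_not_addable (la : seq nat) (p : nat * nat) :
  removable la p -> addable la p = false.
Proof. by move=> /and3P[h _ _]; rewrite /addable h /= !andbF. Qed.

Lemma remaining_id (l i : nat) (sg : bool) (la : seq nat) :
  is_part la -> plus_before_minus l i la ->
  remaining l i sg la = [seq p <- signed_boxes l i la | addable la p == sg].
Proof.
move=> hp hpm; rewrite /remaining cancel_signs_id; last first.
  rewrite /signature -/(signed_boxes l i la) pairwise_map.
  have : pairwise (ladder_le l) (signed_boxes l i la).
    rewrite -(sorted_pairwise (@ladder_le_trans l)).
    exact: sort_sorted (@ladder_le_total l) _.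
  apply: (sub_in_pairwise (P := mem (signed_boxes l i la))); last exact/allP.
  move=> p q; rewrite /= !mem_signed_boxes // => /andP[hp1 /eqP hp2] /andP[_ /eqP hq2] hpq.
  case: (boolP (addable la p)) hp1 => //= _; rewrite orbF => hp1.
  by apply/negP => hq1; have := hpm _ _ hp1 hq1 hp2 hq2; rewrite hpq.
by rewrite /signature filter_map -map_comp map_id.
Qed.

Lemma remaining_sorted (l i : nat) (sg : bool) (la : seq nat) :
  is_part la -> plus_before_minus l i la ->
  pairwise (ladder_le l) (remaining l i sg la).
Proof.
move=> hp hpm; rewrite remaining_id // -(sorted_pairwise (@ladder_le_trans l)).
apply: sorted_filter; first exact: ladder_le_trans.
exact: sort_sorted (@ladder_le_total l) _.
Qed.

Lemma mem_remaining_plus (l i : nat) (la : seq nat) (p : nat * nat) :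
  is_part la -> plus_before_minus l i la ->
  (p \in remaining l i true la) = addable la p && (residue l p == Posz i).
Proof.
move=> hp hpm; rewrite remaining_id // mem_filter mem_signed_boxes // eqb_id.
by case: (addable la p); rewrite ?orbT.
Qed.

Lemma mem_remaining_minus (l i : nat) (la : seq nat) (p : nat * nat) :
  is_part la -> plus_before_minus l i la ->
  (p \in remaining l i false la) = removable la p && (residue l p == Posz i).
Proof.
move=> hp hpm; rewrite remaining_id // mem_filter mem_signed_boxes // eqbF_neg.
have := @removable_not_addable la p.
by case: (removable la p) => [/(_ isT) ->|_] //=; case: (addable la p).
Qed.

(** The box added is the last addable one and becomes removable; it comes after all addable boxes
    that are left, so the invariant survives. *)
Lemma f_hat_step (l i : nat) (la : seq nat) :
  1 < l -> is_part la -> plus_before_minus l i la ->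
  (size (addables l i la) = 0 /\ f_hat l i (Some la) = None) \/
  exists mu p, [/\ f_hat l i (Some la) = Some mu, box_added la mu p,
    residue l p = Posz i & plus_before_minus l i mu].
Proof.
move=> l1 hp hpm; have hmem q := mem_remaining_plus q hp hpm.
have hs := remaining_sorted true hp hpm; rewrite /f_hat /=.
case: (lastP (remaining l i true la)) hmem hs => [|s p] hmem hs; [left|right].
  split=> //; apply/eqP; rewrite size_eq0 -[_ == _]negbK -has_filter.
  by apply/hasPn => q _; rewrite -hmem.
have := hmem p; rewrite mem_rcons mem_head => /esym/andP[hadd /eqP hres].
have hba := add_boxP hp hadd; have [_ pmu _ _ _] := hba.
exists (add_box la p), p; split=> //; first by rewrite rev_rcons.
have hmax q : addable la q -> residue l q = Posz i -> q <> p -> ladder_le l q p.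
  move=> h1 /eqP h2 h3; have := hmem q; rewrite h1 h2 mem_rcons in_cons.
  case: eqP h3 => //= _ _ hq.
  by move: hs; rewrite pairwise_rcons => /andP[/allP/(_ _ hq)].
have nb q : residue l q = Posz i -> q <> p ->
    addable (add_box la p) q = addable la q /\ removable (add_box la p) q = removable la q.
  by move=> hq; apply: (box_added_neighbours hba l1); apply: residue_cong; rewrite hq.
move=> q q' hq hq' rq rq'.
have q'p : q' <> p by move=> E; move: hq'; rewrite E (negbTE (box_added_not_addable hba)).
have [ea _] := nb q' rq' q'p; rewrite ea in hq'.
case: (q =P p) => [->|qp]; last by apply: hpm => //; have [_ <-] := nb q rq qp.
apply/negP => h; apply: (q'p); apply: (ladder_le_anti l1 _ _ (hmax _ hq' rq' q'p) h).
  by case/and5P: hq'.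
by case/and5P: hadd.
Qed.

(** Dually, the first removable box becomes addable and comes before all removable boxes that are
    left. *)
Lemma e_hat_step (l i : nat) (la : seq nat) :
  1 < l -> is_part la -> plus_before_minus l i la ->
  (size (removables l i la) = 0 /\ e_hat l i (Some la) = None) \/
  exists mu p, [/\ e_hat l i (Some la) = Some mu, box_added mu la p,
    residue l p = Posz i & plus_before_minus l i mu].
Proof.
move=> l1 hp hpm; have hmem q := mem_remaining_minus q hp hpm.
have hs := remaining_sorted false hp hpm; rewrite /e_hat /=.
case: (remaining l i false la) hmem hs => [|p s] hmem hs; [left|right].
  split=> //; apply/eqP; rewrite size_eq0 -[_ == _]negbK -has_filter.
  by apply/hasPn => q _; rewrite -hmem.
have := hmem p; rewrite mem_head => /esym/andP[hrem /eqP hres].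
have hba := remove_boxP hp hrem; have [pmu _ _ _ _] := hba.
exists (remove_box la p), p; split=> //.
have hmin q : removable la q -> residue l q = Posz i -> q <> p -> ladder_le l p q.
  move=> h1 /eqP h2 h3; have := hmem q; rewrite h1 h2 in_cons.
  case: eqP h3 => //= _ _ hq.
  by move: hs => /= /andP[/allP/(_ _ hq)].
have nb q : residue l q = Posz i -> q <> p ->
    addable la q = addable (remove_box la p) q /\
    removable la q = removable (remove_box la p) q.
  by move=> hq; apply: (box_added_neighbours hba l1); apply: residue_cong; rewrite hq.
move=> q q' hq hq' rq rq'.
have qp : q <> p by move=> E; move: hq; rewrite E (negbTE (box_added_not_removable hba)).
have [_ er] := nb q rq qp; rewrite -er in hq.
case: (q' =P p) => [->|q'p]; last by apply: hpm => //; have [-> _] := nb q' rq' q'p.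
have pos r : removable la r -> 0 < r.2.
  by case: r => x y; rewrite removableE => /and4P[].
apply/negP => h; apply: (qp).
by apply: (ladder_le_anti l1 _ _ h (hmin _ hq rq qp)); apply: pos.
Qed.

(** * For a JM partition, addable boxes precede removable ones of the same residue *)

Lemma rowpos_lt (la : seq nat) (a b : nat) :
  is_part la -> 0 < a -> a < b -> (rowpos la b < rowpos la a)%R.
Proof.
move=> hp a0 ab; have := @nth_part la a.-1 b.-1 hp; rewrite /rowpos; lia.
Qed.

Lemma colpos_lt (la : seq nat) (a b : nat) :
  is_part la -> 0 < a -> a < b -> (colpos la a < colpos la b)%R.
Proof.
move=> hp a0 ab; have b0 : 0 < b by lia.
have := col_len_cases (col_len la a) hp b0.
have := col_len_cases (col_len la a) hp a0; rewrite /colpos; lia.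
Qed.

Lemma addable_pos (la : seq nat) (x y : nat) :
  is_part la -> addable la (x, y) ->
  rowpos la x = (content (x, y) - 1)%R /\ colpos la y = content (x, y).
Proof.
move=> hp; rewrite addableE => /and3P[x0 /eqP hy hx].
have y0 : 0 < y by lia.
have := col_len_cases x.-1 hp y0; have := col_len_cases x.-2 hp y0.
rewrite /rowpos /colpos /content /=; lia.
Qed.

Lemma removable_pos (la : seq nat) (x y : nat) :
  is_part la -> removable la (x, y) ->
  rowpos la x = content (x, y) /\ colpos la y = (content (x, y) - 1)%R.
Proof.
move=> hp; rewrite removableE => /and4P[x0 y0 /eqP hy hx].
have := col_len_cases x.-1 hp y0; have := col_len_cases x hp y0.
rewrite /rowpos /colpos /content /=; lia.
Qed.

Lemma bead_JM_row (l : int) (la : seq nat) (a b y x : nat) :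
  is_part la -> bead_JM l (bead la) -> (a, b) \in diagram la ->
  (a, y) \in diagram la -> (x, b) \in diagram la ->
  (l %| (rowpos la a - colpos la b)%R)%Z ->
  (l %| (rowpos la a - colpos la y)%R)%Z || (l %| (rowpos la x - colpos la b)%R)%Z.
Proof.
move=> hp JM h1 h2 h3 hl.
have := h1; rewrite mem_diagram => /and3P[a0 b0 _].
have := h2; rewrite mem_diagram => /and3P[_ y0 _].
have := h3; rewrite mem_diagram => /and3P[x0 _ _].
apply: JM => //; rewrite ?colpos_lt_rowpos //; try by apply/beadP; eexists; last reflexivity.
all: by apply/gapP => //; eexists; last reflexivity.
Qed.

(* The hook at the corner of the rectangle spanned by a removable and an addable
   box of the same residue is divisible by [l]; as the removable box has hook
   length 1, the (JM) condition forces a whole arm or leg of hooks divisible by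
   [l], so the rectangle is at least [l - 1] times longer in one direction. *)
Lemma JM_addable_above (l : nat) (la : seq nat) (x y x' y' : nat) :
  1 < l -> is_part la -> bead_JM (Posz l) (bead la) ->
  removable la (x, y) -> addable la (x', y') ->
  (Posz l %| (content (x', y') - content (x, y))%R)%Z ->
  x' <= x -> y < y' -> (l - 1) * (y' - y) <= x - x'.
Proof.
move=> l1 hp JM hr ha hl xx yy.
have [r1 r2] := removable_pos hp hr; have [a1 a2] := addable_pos hp ha.
have := hr; rewrite removableE => /and4P[x0 y0 /eqP hy hx].
have := ha; rewrite addableE => /and3P[x0' /eqP hy' hx'].
have l0 : (0 < Posz l)%R by lia.
have box b : 0 < b -> b < y' -> (x', b) \in diagram la.
  by move=> b0 bb; rewrite mem_diagram; lia.
have hxy : (x, y) \in diagram la by rewrite mem_diagram; lia.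
have h1 : (Posz l %| (rowpos la x' - colpos la y)%R)%Z.
  by rewrite a1 r2 (_ : (_ - _)%R = (content (x', y') - content (x, y))%R) //; lia.
have hdiv b : 0 < b -> b < y' -> (Posz l %| (rowpos la x' - colpos la b)%R)%Z.
  move=> b0 bb; have := bead_JM_row hp JM (box _ y0 yy) (box _ b0 bb) hxy h1.
  rewrite r1 r2 (_ : (_ - (_ - 1))%R = 1%R); last by lia.
  by rewrite (@ndvdz_unit (Posz l) 1) ?orbF //; left.
(* The gaps of columns [y] to [y' - 1] are congruent and distinct, hence at least [l] apart; the
   bound accumulates from column [y' - 1] leftwards. *)
have claim k : k < y' - y ->
    (Posz l * Posz k.+1 <= rowpos la x' - colpos la (y' - k.+1))%R.
  elim: k => [|k IH] hk.
    have b0 : 0 < y' - 1 by lia.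
    have bb : y' - 1 < y' by lia.
    have := box _ b0 bb; rewrite -colpos_lt_rowpos // => h.
    by have := dvdz_lt_add l0 h (hdiv _ b0 bb); lia.
  have b0 : 0 < y' - k.+2 by lia.
  have bb : y' - k.+2 < y' - k.+1 by lia.
  have d : (Posz l %| (colpos la (y' - k.+1) - colpos la (y' - k.+2))%R)%Z.
    have h : (Posz l %| (rowpos la x' - colpos la (y' - k.+1))%R)%Z by apply: hdiv; lia.
    rewrite -(cong_class _ (_ : (Posz l %| (rowpos la x' - colpos la (y' - k.+2))%R)%Z)).
      exact: h.
    by apply: hdiv; lia.
  have := dvdz_lt_add l0 (colpos_lt hp b0 bb) d.
  have := IH ltac:(lia); lia.
have := claim (y' - y).-1 ltac:(lia).
rewrite (_ : (y' - y).-1.+1 = y' - y) ?subKn; try lia.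
rewrite a1 r2 /content /=; nia.
Qed.

(** The transpose of [JM_addable_above]: here the beads of rows [x] to [x' - 1] are congruent, hence
    at least [l] apart. *)
Lemma JM_addable_below (l : nat) (la : seq nat) (x y x' y' : nat) :
  1 < l -> is_part la -> bead_JM (Posz l) (bead la) ->
  removable la (x, y) -> addable la (x', y') ->
  (Posz l %| (content (x', y') - content (x, y))%R)%Z ->
  x < x' -> y' <= y -> (l - 1) * (x' - x) <= y - y'.
Proof.
move=> l1 hp JM hr ha hl xx yy.
have [r1 r2] := removable_pos hp hr; have [a1 a2] := addable_pos hp ha.
have := hr; rewrite removableE => /and4P[x0 y0 /eqP hy hx].
have := ha; rewrite addableE => /and3P[x0' /eqP hy' hx'].
have l0 : (0 < Posz l)%R by lia.
have y0' : 0 < y' by lia.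
have box a : 0 < a -> a < x' -> (a, y') \in diagram la.
  by move=> b0 bb; rewrite mem_diagram; have := @nth_part la a.-1 x'.-2 hp; lia.
have hxy : (x, y) \in diagram la by rewrite mem_diagram; lia.
have h1 : (Posz l %| (rowpos la x - colpos la y')%R)%Z.
  by rewrite a2 r1 cong_sym.
have hdiv a : 0 < a -> a < x' -> (Posz l %| (rowpos la a - colpos la y')%R)%Z.
  move=> b0 bb; have := bead_JM_row hp JM (box _ x0 xx) hxy (box _ b0 bb) h1.
  rewrite r1 r2 (_ : (_ - (_ - 1))%R = 1%R); last by lia.
  by rewrite (@ndvdz_unit (Posz l) 1) ?orbF //; left.
have claim k : k < x' - x ->
    (Posz l * Posz k.+1 <= rowpos la (x' - k.+1) - colpos la y')%R.
  elim: k => [|k IH] hk.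
    have b0 : 0 < x' - 1 by lia.
    have bb : x' - 1 < x' by lia.
    have := box _ b0 bb; rewrite -colpos_lt_rowpos // => h.
    by have := dvdz_lt_add l0 h (hdiv _ b0 bb); lia.
  have b0 : 0 < x' - k.+2 by lia.
  have bb : x' - k.+2 < x' - k.+1 by lia.
  have d : (Posz l %| (rowpos la (x' - k.+2) - rowpos la (x' - k.+1))%R)%Z.
    have h : (Posz l %| (rowpos la (x' - k.+1) - colpos la y')%R)%Z by apply: hdiv; lia.
    rewrite (cong_class (a := colpos la y')) //.
    by apply: hdiv; lia.
  have := dvdz_lt_add l0 (rowpos_lt hp b0 bb) d.
  have := IH ltac:(lia); lia.
have := claim (x' - x).-1 ltac:(lia).
rewrite (_ : (x' - x).-1.+1 = x' - x) ?subKn; try lia.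
rewrite a2 r1 /content /=; nia.
Qed.

Lemma JM_plus_before_minus (l i : nat) (la : seq nat) :
  2 < l -> JM_partition l la -> plus_before_minus l i la.
Proof.
move=> l2 hJ; have hp : is_part la by case: hJ.
move/(JM_partitionE l hp): (hJ) => JM.
move=> [x y] [x' y'] hr ha rp rq; have l1 : 1 < l by lia.
have hl : (Posz l %| (content (x', y') - content (x, y))%R)%Z.
  by apply: residue_cong; rewrite rp rq.
have := hr; rewrite removableE => /and4P[x0 y0 /eqP hy hx].
have := ha; rewrite addableE => /and3P[x0' /eqP hy' hx'].
have h1 := JM_addable_above l1 hp JM hr ha hl.
have h2 := JM_addable_below l1 hp JM hr ha hl.
rewrite /ladder_le /ladder /=.
(* The first and the last case contradict the shape of a partition. In the second the ladders may
   coincide, but [x' < x], so the tie puts the addable box first. *)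
case: (leqP x' x) => xx; case: (leqP y' y) => yy.
- have := @nth_part la x'.-1 x.-1 hp; lia.
- have := h1 xx yy.
  rewrite (_ : (l - 1) * (y' - 1) = (l - 1) * (y - 1) + (l - 1) * (y' - y)).
    have : 0 < (l - 1) * (y' - y) by rewrite muln_gt0; lia.
    lia.
  by rewrite -mulnDr; congr (_ * _); lia.
- have := h2 xx yy.
  rewrite (_ : (l - 1) * (y - 1) = (l - 1) * (y' - 1) + (l - 1) * (y - y')); last first.
    by rewrite -mulnDr; congr (_ * _); lia.
  (* Here [2 < l] enters: with factor 1 instead of 2 the bounds would allow a tie, which goes to the
     removable box in the higher row. *)
  have : 2 * (y - y') <= (l - 1) * (y - y') by rewrite leq_mul2r; lia.
  have : 2 * (x' - x) <= (l - 1) * (x' - x) by rewrite leq_mul2r; lia.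
  lia.
- have := @nth_part la x.-1 x'.-2 hp; lia.
Qed.

(** * The ends and the interior of a string *)

(** Forgetting which pairs were exchanged makes the relation symmetric and transitive, so it passes
    along strings in both directions and feeds [bead_JM_swap]. *)
Definition res_swap (l i : int) (S S' : int -> bool) : Prop :=
  (forall t, ~~ (l %| (t - i)%R)%Z -> ~~ (l %| (t - (i - 1)%R)%R)%Z -> S' t = S t) /\
  (forall t, (l %| (t - i)%R)%Z ->
    (S' t = S t /\ S' (t - 1)%R = S (t - 1)%R) \/
    (S' t = S (t - 1)%R /\ S' (t - 1)%R = S t)).

Lemma res_swap_sym (l i : int) (S S' : int -> bool) :
  res_swap l i S S' -> res_swap l i S' S.
Proof.
move=> [h1 h2]; split=> t => [n1 n2|/h2]; first by rewrite h1.
by move=> [[-> ->]|[-> ->]]; [left|right].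
Qed.

Lemma res_swap_trans (l i : int) (S1 S2 S3 : int -> bool) :
  res_swap l i S1 S2 -> res_swap l i S2 S3 -> res_swap l i S1 S3.
Proof.
move=> [h1 h2] [h3 h4]; split=> t => [n1 n2|h]; first by rewrite h3 ?h1.
have := h2 t h; have := h4 t h.
by move=> [[-> ->]|[-> ->]] [[-> ->]|[-> ->]]; by [left|right].
Qed.

Lemma box_added_res_swap (l i : nat) (la mu : seq nat) (p : nat * nat) :
  1 < l -> i < l -> box_added la mu p -> residue l p = Posz i ->
  res_swap (Posz l) (Posz i) (bead la) (bead mu).
Proof.
move=> l1 il hadd /eqP; rewrite residueE // => hp.
have hb := box_added_bead hadd; have [pla pmu _ _ _] := hadd.
have [b1 b2] := addable_bead pla (box_added_addable hadd).
have l1' : (1 < Posz l)%R by lia.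
have n1 : (Posz l %| 1%R)%Z = false by apply: ndvdz_unit => //; left.
split=> t.
  move=> t1 t2; rewrite hb; case: eqP => [E|_]; first by rewrite E hp in t1.
  case: eqP => [E|_] //=; case/negP: t2.
  by rewrite E (_ : (_ - _)%R = (content p - Posz i)%R) //; lia.
move=> ht; case: (t =P content p) => [->|tp].
  right; rewrite !hb eqxx b1 (negbTE b2) andbF orbF; split=> //.
  by apply/negbTE/eqP; lia.
left; rewrite !hb.
have -> : (t == content p) = false by apply/eqP.
have -> : ((t - 1)%R == (content p - 1)%R) = false by apply/eqP; lia.
have -> : (t == (content p - 1)%R) = false.
  apply/eqP => E; have := hp; rewrite (_ : (_ - _)%R = (t - Posz i + 1)%R); last by lia.
  by rewrite rpredDl // n1.
have -> : ((t - 1)%R == content p) = false.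
  apply/eqP => E; have := hp; rewrite (_ : (_ - _)%R = (t - Posz i - 1)%R); last by lia.
  by rewrite rpredBl // n1.
by [].
Qed.

(** A bead at [t - 1] followed by a gap at [t] would give an addable i-box of [mu]; its absence is
    the one-sided hypothesis of [bead_JM_swap]. *)
Lemma JM_no_addable (l i : nat) (la mu : seq nat) :
  1 < l -> i < l -> is_part la -> is_part mu -> JM_partition l la ->
  res_swap (Posz l) (Posz i) (bead la) (bead mu) ->
  size (addables l i mu) = 0 -> JM_partition l mu.
Proof.
move=> l1 il pla pmu /(JM_partitionE l pla) JM [h1 h2] /size0nil h0.
apply/(JM_partitionE l pmu).
apply: (bead_JM_swap (e := (-1)%R) (j := Posz i)) JM => //; first by right.
move=> t ht hb; apply/negPn/negP => hn.
have [p hp cp] := addable_of_bead pmu hb hn.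
have := mem_addables l i p pmu; rewrite h0 hp residueE // cp ht.
by [].
Qed.

Lemma JM_no_removable (l i : nat) (la mu : seq nat) :
  1 < l -> i < l -> is_part la -> is_part mu -> JM_partition l la ->
  res_swap (Posz l) (Posz i) (bead la) (bead mu) ->
  size (removables l i mu) = 0 -> JM_partition l mu.
Proof.
move=> l1 il pla pmu /(JM_partitionE l pla) JM [h1 h2] /size0nil h0.
apply/(JM_partitionE l pmu).
have sh (t : int) : (Posz l %| (t - (Posz i - 1)%R)%R)%Z = (Posz l %| ((t + 1)%R - Posz i)%R)%Z.
  by congr (_ %| _)%Z; lia.
apply: (bead_JM_swap (e := 1%R) (j := (Posz i - 1)%R)) JM => //.
- by left.
- by move=> t n1; rewrite subrK => n2; apply: h1.
- by move=> t; rewrite sh => /h2; rewrite addrK => -[[-> ->]|[-> ->]]; [left|right].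
move=> t; rewrite sh => ht hb; apply/negPn/negP => hn.
have hn' : ~~ bead mu ((t + 1) - 1)%R by rewrite addrK.
have [p hp cp] := removable_of_bead pmu hn' hb.
have := mem_removables l i p pmu; rewrite h0 hp residueE // cp ht.
by [].
Qed.

Lemma not_JM_mixed (l i : nat) (mu : seq nat) :
  1 < l -> i < l -> is_part mu -> 1 < size (addables l i mu) ->
  0 < size (removables l i mu) -> ~ JM_partition l mu.
Proof.
move=> l1 il pmu ha hr /(JM_partitionE l pmu).
have := mem_addables l i _ pmu; have := mem_removables l i _ pmu.
have : uniq (addables l i mu) by rewrite filter_uniq ?positions_uniq.
case: (addables l i mu) ha => [|p [|q s]] // _.
case: (removables l i mu) hr => [|r s'] // _ /= /andP[+ _] hr ha.
rewrite in_cons negb_or => /andP[/eqP pq _].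
have := hr r; rewrite in_cons eqxx residueE // => /esym/andP[r1 r2].
have := ha p; rewrite in_cons eqxx residueE // => /esym/andP[p1 p2].
have := ha q; rewrite !in_cons eqxx orbT residueE // => /esym/andP[q1 q2].
have [p3 p4] := addable_bead pmu p1; have [q3 q4] := addable_bead pmu q1.
have [r3 r4] := removable_bead pmu r1.
have l1' : (1 < Posz l)%R by lia.
have ne : content p <> content q by move=> /(addable_content_inj pmu p1 q1).
case: (ltrP (content p) (content q)) => h.
  exact: (@not_bead_JM_mixed _ (Posz i) (content p) (content q) (content r)).
apply: (@not_bead_JM_mixed _ (Posz i) (content q) (content p) (content r)) => //.
by lia.
Qed.

(** * Iterating the operators *)

Lemma iter_f_hat (l i : nat) (la : seq nat) (k : nat) :
  1 < l -> i < l -> is_part la -> plus_before_minus l i la ->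
  k <= size (addables l i la) ->
  exists mu, [/\ iter k (f_hat l i) (Some la) = Some mu, is_part mu,
    plus_before_minus l i mu & res_swap (Posz l) (Posz i) (bead la) (bead mu)] /\
    (size (addables l i mu) = size (addables l i la) - k /\
     size (removables l i mu) = size (removables l i la) + k).
Proof.
move=> l1 il hp hpm; elim: k => [|k IH] hk.
  by exists la; rewrite subn0 addn0; split=> //; split=> //; split=> // t _; left.
have [mu [[h1 h2 h3 h4] [h5 h6]]] := IH (ltnW hk).
have [[h7 _]|[nu [p [h7 h8 h9 h10]]]] := f_hat_step l1 h2 h3; first by lia.
have [_ h11 _ _ _] := h8; have [h12 h13] := box_added_sizes l1 h8 h9.
exists nu; split; last by lia.
split=> //; first by rewrite iterS h1.
exact: res_swap_trans h4 (box_added_res_swap l1 il h8 h9).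
Qed.

Lemma iter_e_hat (l i : nat) (la : seq nat) (k : nat) :
  1 < l -> i < l -> is_part la -> plus_before_minus l i la ->
  k <= size (removables l i la) ->
  exists mu, [/\ iter k (e_hat l i) (Some la) = Some mu, is_part mu,
    plus_before_minus l i mu & res_swap (Posz l) (Posz i) (bead la) (bead mu)] /\
    (size (removables l i mu) = size (removables l i la) - k /\
     size (addables l i mu) = size (addables l i la) + k).
Proof.
move=> l1 il hp hpm; elim: k => [|k IH] hk.
  by exists la; rewrite subn0 addn0; split=> //; split=> //; split=> // t _; left.
have [mu [[h1 h2 h3 h4] [h5 h6]]] := IH (ltnW hk).
have [[h7 _]|[nu [p [h7 h8 h9 h10]]]] := e_hat_step l1 h2 h3; first by lia.
have [h11 _ _ _ _] := h8; have [h12 h13] := box_added_sizes l1 h8 h9.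
exists nu; split; last by lia.
split=> //; first by rewrite iterS h1.
exact: res_swap_trans h4 (res_swap_sym (box_added_res_swap l1 il h8 h9)).
Qed.

Lemma is_max_iter (f : option (seq nat) -> option (seq nat)) (x : option (seq nat)) (n : nat) :
  f None = None -> iter n f x <> None -> iter n.+1 f x = None ->
  is_max (fun n => iter n f x <> None) n.
Proof.
move=> f0 h1 h2; split=> // m hm; rewrite leqNgt; apply/negP => nm; apply: hm.
rewrite -(subnK nm) iterD h2; elim: (m - n.+1) => //= k ->; exact: f0.
Qed.

Theorem theorem4p7 (l : nat) (hl : 2 < l) (la : seq nat)
    (hla : JM_partition l la) (i : nat) (hi : i < l) :
  exists phi eps : nat,
    [/\ is_max (fun n => iter n (f_hat l i) (Some la) <> None) phi
      & is_max (fun n => iter n (e_hat l i) (Some la) <> None) eps] /\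
    [/\ exists2 mu, iter phi (f_hat l i) (Some la) = Some mu
          & JM_partition l mu,
        exists2 mu, iter eps (e_hat l i) (Some la) = Some mu
          & JM_partition l mu,
        forall k : nat, 0 < k < phi - 1 ->
          exists2 mu, iter k (f_hat l i) (Some la) = Some mu
            & is_part mu /\ ~ JM_partition l mu
      & forall k : nat, 1 < k < eps ->
          exists2 mu, iter k (e_hat l i) (Some la) = Some mu
            & is_part mu /\ ~ JM_partition l mu].
Proof.
have hp : is_part la by case: hla.
have hpm := @JM_plus_before_minus l i la hl hla.
have l1 : 1 < l by lia.
have F k := @iter_f_hat l i la k l1 hi hp hpm.
have E k := @iter_e_hat l i la k l1 hi hp hpm.
(* Each step turns one addable i-box into a removable one or conversely, so these counts are the
   lengths of the strings. *)
exists (size (addables l i la)), (size (removables l i la)).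
have [mu [[f1 f2 f3 f4] [f5 f6]]] := F _ (leqnn _).
have [nu [[e1 e2 e3 e4] [e5 e6]]] := E _ (leqnn _).
rewrite subnn in f5; rewrite subnn in e5.
split; split.
- apply: is_max_iter; rewrite // ?f1 // iterS f1.
  by have [[_]//|[? [p [_ h2 h3 _]]]] := f_hat_step l1 f2 f3;
    have := box_added_sizes l1 h2 h3; lia.
- apply: is_max_iter; rewrite // ?e1 // iterS e1.
  by have [[_]//|[? [p [_ h2 h3 _]]]] := e_hat_step l1 e2 e3;
    have := box_added_sizes l1 h2 h3; lia.
- by exists mu => //; apply: (JM_no_addable l1 hi hp) f4 f5.
- by exists nu => //; apply: (JM_no_removable l1 hi hp) e4 e5.
(* At least two addable boxes are left because [k < phi - 1], and at least one box is removable
   because [0 < k]. *)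
- move=> k hk; have [|xi [[h1 h2 _ _] [h3 h4]]] := F k; first by lia.
  by exists xi => //; split=> //; apply: not_JM_mixed hi h2 _ _ => //; lia.
(* The roles change: [1 < k] provides two addable boxes and [k < eps] leaves a removable one. *)
- move=> k hk; have [|xi [[h1 h2 _ _] [h3 h4]]] := E k; first by lia.
  by exists xi => //; split=> //; apply: not_JM_mixed hi h2 _ _ => //; lia.
Qed.
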